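(* Let $\gamma>0$ and $V(x)=\frac{1}{\gamma+1}|x|^{\gamma+1}$. Let $\lambda>0$ be an eigenvalue and let $u$ be a (nontrivial) solution of $$-u''+V'u'=\lambda u\quad\text{on }\mathbb R,\qquad u\in L^2(\varrho_{1,\infty}dx).$$ Let $x^*$ be the turning point associated with $\lambda$, and let $n$ be an integer with $n>\frac{1+\gamma}{2\gamma}$. If $u(x^* )\ge0$, then on $[x^*,\infty)$ $$u(x)\approx e^{\sum_{i=1}^nS_i(x)}.$$ Moreover, there exist constants $C_2,C_3,\dots,C_n\in\mathbb R$ such that on $[x^*,\infty)$ $$u(x)\approx\begin{cases}e^{\lambda\frac{|x|^{1-\gamma}}{1-\gamma}+\sum_{i=2}^nC_i|x|^{1-(2i-1)\gamma}}, & \text{if }\gamma^{-1}\text{ is not an odd positive integer},\\[4pt] e^{\lambda\frac{|x|^{1-\gamma}}{1-\gamma}+\sum_{i=2}^{m-1}C_i|x|^{1-(2i-1)\gamma}+C_m\log(|x|)}, & \text{if }\gamma=\frac{1}{2m-1}\text{ for some integer }m\text{ with }2\le m<n.\end{cases}$$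
   Context: $\varrho_{1,\infty}(x)=C_1e^{-V(x)}$, with $C_1$ the constant making it a probability density. For positive functions on a domain $D$, $f\approx g$ on $D$ means that there is a constant $C\ge1$ with $\frac1Cg(x)\le f(x)\le Cg(x)$ for all $x\in D$. The turning point $x^*>0$ is the turning point (zero) of $T(x)=\frac{|V'(x)|^2}{4}-\frac{V''(x)}{2}-\lambda$ such that $T(x)\ge0$ for all $x\ge x^*$. With $f(x)=V'(x)=x^\gamma$ for $x\ge x^*$, the functions $S_k$ on $[x^*,\infty)$ are defined by $$S_1(x)=\int_{x^*}^x\frac{\lambda}{f(s)}\,ds,\qquad S_k'(x)=\frac{1}{f(x)}S_{k-1}''(x)+\frac{1}{f(x)}\sum_{j=1}^{k-1}S_j'(x)S_{k-j}'(x),\quad S_k(x^* )=0,\quad k\ge2.$$ *)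

(* Defs.v *)
From HB Require Import structures.
From mathcomp Require Import all_boot all_order all_algebra.
From mathcomp Require Import all_classical all_reals all_analysis.
Set Implicit Arguments.
Unset Strict Implicit.
Unset Printing Implicit Defensive.
Import Order.TTheory GRing.Theory Num.Theory.
Import numFieldNormedType.Exports.
Local Open Scope ring_scope.
Local Open Scope classical_set_scope.

Section WithReals.
Context {R : realType}.
Implicit Types (V u f g : R -> R) (gamma lambda x xs : R).

Local Notation mu := (@lebesgue_measure R).

Definition potential gamma : R -> R :=
  fun x => (gamma + 1)^-1 * `|x| `^ (gamma + 1).

Definition density V : R -> R :=
  fun x => (\int[mu]_y expR (- V y))^-1 * expR (- V x).

(* [derive1] is total, so differentiability is required separately. *)
Definition solution V lambda u : Prop :=
  [/\ forall x, derivable u x 1,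
      forall x, derivable (derive1 u) x 1 &
      forall x, - derive1n 2 u x + derive1 V x * derive1 u x = lambda * u x].

Definition in_L2 (rho : R -> R) u : Prop :=
  measurable_fun [set: R] u /\
  mu.-integrable [set: R] (fun x => (u x ^+ 2 * rho x)%:E).

Definition ode_eigenfunction V lambda u : Prop :=
  [/\ solution V lambda u, in_L2 (density V) u & exists x, u x != 0].

Definition ode_eigenvalue V lambda : Prop := exists u, ode_eigenfunction V lambda u.

Definition Tfun V lambda : R -> R :=
  fun x => `|derive1 V x| ^+ 2 / 4 - derive1n 2 V x / 2 - lambda.

Definition turning_point V lambda xs : Prop :=
  [/\ 0 < xs, Tfun V lambda xs = 0 &
      forall x, xs <= x -> 0 <= Tfun V lambda x].

(* The values of [S k] to the left of [xs] are irrelevant. Since [derive1] is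
   a two-sided derivative, the recursion is imposed on ]xs, +oo[; together with
   continuity on [xs, +oo[ and the value at [xs] it determines [S k] there, and
   the equation at [xs] itself then holds for the right derivatives. *)
Definition expansion f lambda xs (S : nat -> R -> R) : Prop :=
  (forall x, xs <= x -> S 1%N x = \int[mu]_(s in `[xs, x]) (lambda / f s)) /\
  (forall k, (2 <= k)%N ->
    [/\ S k xs = 0,
        {within `[xs, +oo[, continuous (S k)} &
        forall x, xs < x ->
          derivable (S k) x 1 /\
          derive1 (S k) x = (f x)^-1 * derive1n 2 (S k.-1) x
            + (f x)^-1 *
              \sum_(1 <= j < k) derive1 (S j) x * derive1 (S (k - j)%N) x]).

Definition approx_on (D : set R) f g : Prop :=
  exists2 C : R, 1 <= C & forall x, D x -> C^-1 * g x <= f x <= C * g x.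

End WithReals.

(* Main.v *)
Require Import Defs.
From mathcomp Require Import all_boot all_order all_algebra.
From mathcomp Require Import all_classical all_reals all_analysis.
From mathcomp Require Import measurable_realfun ring lra.
Import Order.TTheory GRing.Theory Num.Theory.
Import numFieldNormedType.Exports.
Local Open Scope ring_scope.
Local Open Scope classical_set_scope.
Set Implicit Arguments.
Unset Strict Implicit.
Unset Printing Implicit Defensive.

(** Put f = V', so that f x = x^gamma for x > 0, and v = u'/u.  The statement is
    an asymptotic expansion of v up to an error integrable at infinity: if h is
    an antiderivative of a function differing from v by O(x^(-p)) with p > 1,
    then ln u - h is bounded, that is, u is comparable to exp h.

    Sign information.  The function w = u exp(-V/2) solves w'' = T w, hence
    (w w')' = w'^2 + T w^2 >= 0 beyond the turning point.  Since w is square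
    integrable this forces w w' <= 0, as otherwise w^2 would increase from some
    point on.  By uniqueness for the Cauchy problem w has no zero beyond xs, so
    u > 0 there, and w' <= 0 says v <= f/2.  Moreover u' > 0, because u' exp(-V)
    decreases while u > 0 and u would otherwise become negative.  Thus
    0 < v <= f/2 (lemmas [eigenfunction_gt0], [eigenfunction_derive_le] and
    [eigenfunction_derive_gt0]).

    Instability.  The function v solves the Riccati equation
    v' = f v - lambda - v^2.  For an approximate solution P = O(x^(-gamma)) with
    residual r = f P - lambda - P^2 - P', the error d = v - P satisfies
    d' = A d + r with A = f - v - P >= f/4 eventually.  This equation is so
    unstable that a solution which is O(f) must be as small as r/f: if B
    decreases and |r| <= (f/4) B, then (d^2 - B^2) exp(-V/4) is nondecreasing,
    and a positive value of it would make d^2 grow like exp(V/4)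
    ([unstable_bound]).

    Residuals.  For P = q_1 + ... + q_N with f q_1 = lambda and
    f q_k = q_1 q_(k-1) + ... + q_(k-1) q_1 + rem_k, the residual only contains
    the rem_k, the products q_i q_j with i + j > N, and P'.  All these functions
    are finite sums of real powers of x, so sizes are read off the exponents:
    q_k has order max(-(2k-1) gamma, -(1+2 gamma)), and the error d is
    O(x^(-p)) with p = min((2N+1) gamma, 1+2 gamma) ([log_derivative_expansion],
    [approx_expR_of_expansion]).

    This is applied twice.  With q_k = S_k' and rem_k = S_(k-1)'' it gives the
    comparison with the exponential of the sum of the S_k.  With rem_k = 0 the
    solutions are the single powers q_k = D_k x^(-(2k-1) gamma), where
    D_k is the sum of the D_j D_(k-j); their antiderivatives are powers, or a
    logarithm when (2k-1) gamma = 1, and give the explicit formulas, with N = n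
    in the first case and N = m in the second. *)

(** * Calculus on half-lines *)

Section Calculus.
Context {R : realType}.
Implicit Types (f g h df dg : R -> R) (a b c x y : R).

Lemma is_derive_continuous f l x : is_derive x 1 f l -> {for x, continuous f}.
Proof.
by move=> [+ _] => /derivable1_diffP /differentiable_continuous.
Qed.

Lemma is_derive_opp f x l : is_derive x 1 f l ->
  is_derive x 1 (fun y => - f y) (- l).
Proof. by move=> fD; exact: (is_deriveN fD). Qed.

Lemma le_of_derive_ge0 g dg x y :
  (forall z, x <= z -> z <= y -> is_derive z 1 g (dg z)) ->
  (forall z, x <= z -> z <= y -> 0 <= dg z) ->
  x <= y -> g x <= g y.
Proof.
move=> gD dg_ge0 xy.
have [z|z|c /[!in_itv]/= /andP[xc cy] gyx] := @MVT_segment R g dg x y xy.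
- by move=> /[!in_itv]/= /andP[xz zy]; apply: gD; exact: ltW.
- apply: continuous_in_subspaceT => {}z /[!inE]/= /[!in_itv]/= /andP[xz zy].
  by apply: is_derive_continuous; exact: gD.
- by rewrite -subr_ge0 gyx mulr_ge0 ?subr_ge0// dg_ge0.
Qed.

Lemma nondecreasing_of_derive_ge0 g dg a :
  (forall x, a <= x -> is_derive x 1 g (dg x)) ->
  (forall x, a <= x -> 0 <= dg x) ->
  forall x y, a <= x -> x <= y -> g x <= g y.
Proof.
move=> gD dg_ge0 x y ax xy; apply: le_of_derive_ge0 xy => z xz _.
- by apply: gD; exact: le_trans xz.
- by apply: dg_ge0; exact: le_trans xz.
Qed.

Lemma nonincreasing_of_derive_le0 g dg a :
  (forall x, a <= x -> is_derive x 1 g (dg x)) ->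
  (forall x, a <= x -> dg x <= 0) ->
  forall x y, a <= x -> x <= y -> g y <= g x.
Proof.
move=> gD dg_le0 x y ax xy; rewrite -lerN2.
apply: (@nondecreasing_of_derive_ge0 (fun z => - g z) (fun z => - dg z) a) => // z az.
- by apply: is_derive_opp; exact: gD.
- by rewrite oppr_ge0 dg_le0.
Qed.

Lemma decreasing_of_derive_lt0 g dg a :
  (forall x, a <= x -> is_derive x 1 g (dg x)) ->
  (forall x, a <= x -> dg x < 0) ->
  forall x y, a <= x -> x < y -> g y < g x.
Proof.
move=> gD dg_lt0 x y ax xy.
have [|z|c /[!in_itv]/= /andP[xc cy] gyx] := @MVT R g dg x y xy.
- move=> z /[!in_itv]/= /andP[xz _]; apply: gD; lra.
- apply: continuous_in_subspaceT => z' /[!inE]/= /[!in_itv]/= /andP[xz _].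
  apply: is_derive_continuous; apply: gD; lra.
- by rewrite -subr_lt0 gyx nmulr_rlt0 ?subr_gt0// dg_lt0//; lra.
Qed.

Lemma is_derive_powR e x : 0 < x ->
  is_derive x 1 (fun y => y `^ e) (e * x `^ (e - 1)).
Proof. exact: is_derive1_powR. Qed.

Lemma is_derive_near_right g h l a x : a < x -> (forall y, a < y -> g y = h y) ->
  is_derive x 1 g l -> is_derive x 1 h l.
Proof.
move=> ax gh; apply: near_eq_is_derive.
by near=> y; apply: gh; near: y; exact: lt_nbhsr.
Unshelve. all: by end_near. Qed.

Lemma is_derive_mul f g x l m : is_derive x 1 f l -> is_derive x 1 g m ->
  is_derive x 1 (fun y => f y * g y) (l * g x + f x * m).
Proof.
move=> fD gD; apply: (is_derive_eq (is_deriveM fD gD)).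
by rewrite /GRing.scale/= addrC mulrC.
Qed.

Lemma is_derive_add f g x l m : is_derive x 1 f l -> is_derive x 1 g m ->
  is_derive x 1 (fun y => f y + g y) (l + m).
Proof. by move=> fD gD; exact: (is_deriveD fD gD). Qed.

Lemma is_derive_scale f x c l : is_derive x 1 f l ->
  is_derive x 1 (fun y => c * f y) (c * l).
Proof.
move=> fD; have := is_derive_mul (is_derive_cst c x 1) fD.
by rewrite mul0r add0r.
Qed.

Lemma is_derive_chain f g x l m : is_derive (g x) 1 f l -> is_derive x 1 g m ->
  is_derive x 1 (fun y => f (g y)) (l * m).
Proof. by move=> fD gD; exact: (is_derive1_comp fD gD). Qed.

Lemma is_derive_expR_comp f x l : is_derive x 1 f l ->
  is_derive x 1 (fun y => expR (f y)) (expR (f x) * l).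
Proof. by move=> fD; apply: is_derive_chain fD. Qed.

Lemma is_derive_sum_nat (F : nat -> R -> R) (dF : nat -> R) (m n : nat) x :
  (forall i, (m <= i < n)%N -> is_derive x 1 (F i) (dF i)) ->
  is_derive x 1 (fun y => \sum_(m <= i < n) F i y) (\sum_(m <= i < n) dF i).
Proof.
elim: n => [|n IHn] FD.
  rewrite big_geq//; under eq_fun do rewrite big_geq//; exact: is_derive_cst.
have [mn|nm] := leqP m n; last first.
  rewrite big_geq//; under eq_fun do rewrite big_geq//; exact: is_derive_cst.
rewrite big_nat_recr//=; under eq_fun do rewrite big_nat_recr//=.
apply: is_derive_add; last by apply: FD; rewrite mn ltnS leqnn.
by apply: IHn => i /andP[mi iN]; apply: FD; rewrite mi ltnW.
Qed.

Lemma within_continuousB (D : set R) (f g : R -> R) : {within D, continuous f} ->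
  {within D, continuous g} -> {within D, continuous (fun x => f x - g x)}.
Proof. move=> cf cg x; apply: cvgB; [exact: cf|exact: cg]. Qed.
Lemma within_continuousD (D : set R) (f g : R -> R) : {within D, continuous f} ->
  {within D, continuous g} -> {within D, continuous (fun x => f x + g x)}.
Proof. move=> cf cg x; apply: cvgD; [exact: cf|exact: cg]. Qed.
Lemma within_continuous_sum (D : set R) (r : seq nat) (F : nat -> R -> R) :
  (forall i, i \in r -> {within D, continuous (F i)}) ->
  {within D, continuous (fun x => \sum_(i <- r) F i x)}.
Proof.
elim: r => [|i r IHr] Fc.
  under eq_fun do rewrite big_nil; exact: continuous_subspaceT (@cst_continuous _ _ 0).
under eq_fun do rewrite big_cons.
apply: within_continuousD; first by apply: Fc; exact: mem_head.
by apply: IHr => j jr; apply: Fc; rewrite in_cons jr orbT.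
Qed.

End Calculus.

(** * Finite sums of real powers *)

Section PowerSums.
Context {R : realType}.
Implicit Types (g h k : R -> R) (a b c e x : R).

(** Finite real linear combinations of the x^e with e <= b.  Membership only
    concerns the values on ]a, +oo[, where the S_k' are determined; this class
    is stable under differentiation, unlike mere O(x^b) bounds. *)
Inductive power_sum a b : (R -> R) -> Prop :=
| power_sum_term c e g of e <= b & (forall x, a < x -> g x = c * x `^ e) :
    power_sum a b g
| power_sum_add g h k of power_sum a b g & power_sum a b h
    & (forall x, a < x -> k x = g x + h x) : power_sum a b k.

Lemma power_sum_eq a b g h : power_sum a b g ->
  (forall x, a < x -> h x = g x) -> power_sum a b h.
Proof.
case=> [c e {}g eb gE hE|g1 g2 {}g g1P g2P gE hE].
- by apply: (power_sum_term (c := c) eb) => x ax; rewrite hE// gE.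
- by apply: (power_sum_add g1P g2P) => x ax; rewrite hE// gE.
Qed.

Lemma power_sumW a b b' g : b <= b' -> power_sum a b g -> power_sum a b' g.
Proof.
move=> bb'; elim=> [c e {}g eb gE|g1 g2 {}g _ g1P _ g2P gE].
- exact: (power_sum_term (le_trans eb bb') gE).
- exact: (power_sum_add g1P g2P gE).
Qed.

Lemma power_sumD a b g h : power_sum a b g -> power_sum a b h ->
  power_sum a b (fun x => g x + h x).
Proof. by move=> gP hP; exact: (power_sum_add gP hP). Qed.

Lemma power_sum0 a b : power_sum a b (fun=> 0).
Proof. by apply: (power_sum_term (c := 0) (lexx b)) => x _; rewrite mul0r. Qed.

Lemma power_sum_sum a b (r : seq nat) (P : pred nat) (F : nat -> R -> R) :
  (forall i, i \in r -> P i -> power_sum a b (F i)) ->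
  power_sum a b (fun x => \sum_(i <- r | P i) F i x).
Proof.
elim: r => [|i r IHr] FP.
  by under eq_fun do rewrite big_nil; exact: power_sum0.
have rP : power_sum a b (fun x => \sum_(i <- r | P i) F i x).
  by apply: IHr => j jr; apply: FP; rewrite in_cons jr orbT.
have [Pi|/negPf Pi] := boolP (P i).
- under eq_fun do rewrite big_cons Pi.
  by apply: power_sumD => //; apply: FP => //; exact: mem_head.
- by under eq_fun do rewrite big_cons Pi.
Qed.

Lemma power_sumM a b b' g h : 0 <= a -> power_sum a b g -> power_sum a b' h ->
  power_sum a (b + b') (fun x => g x * h x).
Proof.
move=> a_ge0 gP hP; elim: gP => [c e {}g eb gE|g1 g2 {}g _ g1P _ g2P gE].
- elim: hP => [c' e' {}h eb' hE|h1 h2 {}h _ h1P _ h2P hE].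
  + apply: (power_sum_term (c := c * c') (lerD eb eb')) => x ax.
    rewrite gE// hE// powRD; first by ring.
    by rewrite (gt_eqF (le_lt_trans a_ge0 ax)) implybT.
  + by apply: (power_sum_add h1P h2P) => x ax; rewrite hE// mulrDr.
- by apply: (power_sum_add g1P g2P) => x ax; rewrite gE// mulrDl.
Qed.

Lemma power_sumN a b g : power_sum a b g -> power_sum a b (fun x => - g x).
Proof.
elim=> [c e {}g eb gE|g1 g2 {}g _ g1P _ g2P gE].
- by apply: (power_sum_term (c := - c) eb) => x ax; rewrite gE// mulNr.
- by apply: (power_sum_add g1P g2P) => x ax; rewrite gE// opprD.
Qed.

Lemma power_sum_derive a b g : 0 <= a -> power_sum a b g ->
  exists2 dg, power_sum a (b - 1) dg &
    forall x, a < x -> is_derive x 1 g (dg x).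
Proof.
move=> a_ge0; elim=> [c e {}g eb gE|g1 g2 {}g _ [d1 d1P g1D] _ [d2 d2P g2D] gE].
- exists (fun x => c * (e * x `^ (e - 1))).
    apply: (power_sum_term (c := c * e) (e := e - 1)); first by rewrite lerD2r.
    by move=> x _; rewrite mulrA.
  move=> x ax; apply: (is_derive_near_right ax (fun y ay => esym (gE y ay))).
  by apply: is_derive_scale; apply: is_derive_powR; exact: le_lt_trans ax.
- exists (fun x => d1 x + d2 x); first exact: power_sumD.
  move=> x ax; apply: (is_derive_near_right ax (fun y ay => esym (gE y ay))).
  by apply: is_derive_add; [exact: g1D|exact: g2D].
Qed.

Lemma power_sum_bound a b g : power_sum a b g ->
  exists2 K, 0 < K & forall x, a < x -> 1 <= x -> `|g x| <= K * x `^ b.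
Proof.
elim=> [c e {}g eb gE|g1 g2 {}g _ [K1 K1_gt0 g1K] _ [K2 K2_gt0 g2K] gE].
- exists (`|c| + 1); first by rewrite ltr_wpDl.
  move=> x ax x_ge1; rewrite gE// normrM (ger0_norm (powR_ge0 _ _)).
  by apply: ler_pM => //; [exact: powR_ge0|rewrite lerDl|exact: ler_powR].
- exists (K1 + K2); first exact: addr_gt0.
  move=> x ax x_ge1; rewrite gE// mulrDl (le_trans (ler_normD _ _))// lerD//.
  + exact: g1K.
  + exact: g2K.
Qed.

End PowerSums.

(** * Instability of the linearised Riccati equation *)

Section Instability.
Context {R : realType}.
Implicit Types (gamma a b c e x y : R).

Lemma expR_dominates_square c a : 0 < c -> 0 < a ->
  exists Y, forall y, Y <= y -> y ^+ 2 < c * expR (a * y).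
Proof.
move=> c_gt0 a_gt0; pose b := c * (a / 3) ^+ 3.
have b_gt0 : 0 < b by rewrite mulr_gt0// exprn_gt0// divr_gt0.
(* exp(ay) = exp(ay/3)^3 >= (ay/3)^3, and c (ay/3)^3 = (b y) y^2. *)
exists (b^-1 + 1) => y yY.
have y_gt0 : 0 < y by apply: lt_le_trans yY; rewrite addr_gt0// invr_gt0.
have by_gt1 : 1 < b * y.
  by rewrite mulrC -ltr_pdivrMr// div1r (lt_le_trans _ yY)// ltrDl.
apply: (@lt_le_trans _ _ (b * y * y ^+ 2)).
  by rewrite ltr_pMl// exprn_gt0.
have -> : b * y * y ^+ 2 = c * (a * y / 3) ^+ 3 by rewrite /b; ring.
have -> : expR (a * y) = expR (a * y / 3) ^+ 3.
  by rewrite -expRM_natl; congr expR; field.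
rewrite ler_pM2l// lerXn2r ?nnegrE ?expR_ge0//; last first.
  by rewrite (le_trans _ (expR_ge1Dx _))// lerDr.
by rewrite divr_ge0// mulr_ge0// ltW.
Qed.

Lemma expR_powR_unbounded gamma c X : 0 < gamma -> 0 < c ->
  exists2 x, X <= x & (x `^ gamma) ^+ 2 < c * expR ((4 * (gamma + 1))^-1 * x `^ (gamma + 1)).
Proof.
move=> gamma_gt0 c_gt0.
have [|Y Yexp] := @expR_dominates_square c (4 * (gamma + 1))^-1 c_gt0.
  by rewrite invr_gt0 mulr_gt0// addr_gt0.
pose x := Num.max X (Num.max Y 1).
have [xX xY x1] : [/\ X <= x, Y <= x & 1 <= x].
  by rewrite /x !le_max !lexx !orbT.
exists x => //.
have xle : x `^ gamma <= x `^ (gamma + 1) by rewrite ler_powR// lerDl.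
apply: le_lt_trans (Yexp _ _).
  by rewrite lerXn2r ?nnegrE ?powR_ge0.
rewrite (le_trans xY)// -{1}(powRr1 (le_trans ler01 x1)) ler_powR//.
by rewrite lerDr ltW.
Qed.

(** The function (d^2 - B^2) exp(-W), with B = K x^(-q) and W' = x^gamma/4, is
    nondecreasing, so a positive value of d^2 - B^2 would grow like exp W and
    exceed every power of x.  Working with squares treats both signs of d at once
    and gives monotonicity on the whole half-line, even where |d| < B. *)
Lemma unstable_bound gamma X q K (d A r : R -> R) :
  0 < gamma -> 0 < X -> 0 <= q -> 0 <= K ->
  (forall x, X <= x -> is_derive x 1 d (A x * d x + r x)) ->
  (forall x, X <= x -> x `^ gamma / 4 <= A x) ->
  (forall x, X <= x -> `|r x| <= x `^ gamma / 4 * (K * x `^ (- q))) ->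
  (forall x, X <= x -> `|d x| <= x `^ gamma) ->
  forall x, X <= x -> `|d x| <= K * x `^ (- q).
Proof.
move=> gamma_gt0 X_gt0 q_ge0 K_ge0 dD A_ge r_le d_le x0 Xx0.
pose B x := K * x `^ (- q).
pose dB x := K * (- q * x `^ (- q - 1)).
pose W x := (4 * (gamma + 1))^-1 * x `^ (gamma + 1).
pose phi x := d x * d x - B x * B x.
have B_ge0 x : 0 <= B x by rewrite mulr_ge0// powR_ge0.
have BD x : X <= x -> is_derive x 1 B (dB x).
  by move=> Xx; apply: is_derive_scale; apply: is_derive_powR; lra.
have WD x : X <= x -> is_derive x 1 W (x `^ gamma / 4).
  move=> Xx; have := is_derive_scale (4 * (gamma + 1))^-1
    (@is_derive_powR R (gamma + 1) x (lt_le_trans X_gt0 Xx)).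
  rewrite addrK; congr (is_derive _ _ _ _); field; lra.
pose g x := phi x * expR (- W x).
pose dphi x := ((A x * d x + r x) * d x + d x * (A x * d x + r x))
  - (dB x * B x + B x * dB x).
pose dg x := dphi x * expR (- W x) + phi x * (expR (- W x) * - (x `^ gamma / 4)).
have gD x : X <= x -> is_derive x 1 g (dg x).
  move=> Xx; apply: is_derive_mul.
  - apply: is_derive_add; first by apply: is_derive_mul; exact: dD.
    by apply: is_derive_opp; apply: is_derive_mul; exact: BD.
  - by apply: is_derive_expR_comp; apply: is_derive_opp; exact: WD.
have dg_ge0 x : X <= x -> 0 <= dg x.
  move=> Xx.
  have -> : dg x = (dphi x - phi x * (x `^ gamma / 4)) * expR (- W x).
    by rewrite /dg; ring.
  rewrite mulr_ge0 ?expR_ge0// /dphi /phi.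
  have dB_le0 : 0 <= B x * - dB x.
    by rewrite mulr_ge0// /dB -mulrN mulr_ge0// mulNr opprK mulr_ge0// powR_ge0.
  have Ad : x `^ gamma / 4 * (d x) ^+ 2 <= A x * (d x) ^+ 2.
    by rewrite ler_wpM2r ?sqr_ge0// A_ge.
  have rd : - (r x * d x) <= x `^ gamma / 4 * B x * `|d x|.
    rewrite (le_trans (ler_norm _))// normrN normrM ler_wpM2r//.
    exact: r_le.
  have sq : 0 <= x `^ gamma / 4 * (`|d x| - B x) ^+ 2.
    by rewrite mulr_ge0 ?sqr_ge0// divr_ge0// powR_ge0.
  have sqE : (`|d x| - B x) ^+ 2 = d x ^+ 2 - 2 * B x * `|d x| + B x ^+ 2.
    by rewrite sqrrB real_normK ?num_real// -mulr_natr; ring.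
  (* B' <= 0, A >= f/4 and |r| <= (f/4) B leave the square (f/4)(|d| - B)^2. *)
  rewrite sqE in sq; nra.
rewrite leNgt; apply/negP => Bd.
have phi0 : 0 < phi x0.
  rewrite /phi -!expr2 subr_gt0 -(real_normK (num_real (d x0))).
  by rewrite ltrXn2r// nnegrE.
have g0 : 0 < g x0 by rewrite mulr_gt0// expR_gt0.
have [x x0x] := expR_powR_unbounded x0 gamma_gt0 g0.
apply/negP; rewrite -leNgt.
have Xx : X <= x by exact: le_trans x0x.
have gg : g x0 <= g x := nondecreasing_of_derive_ge0 gD dg_ge0 Xx0 x0x.
rewrite -/(W x) -ler_pdivlMr ?expR_gt0// -expRN.
apply: (le_trans gg); rewrite /g ler_wpM2r ?expR_ge0// /phi -!expr2.
apply: (@le_trans _ _ (d x ^+ 2)); first by rewrite gerBl sqr_ge0.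
rewrite -(real_normK (num_real (d x))) lerXn2r ?nnegrE ?powR_ge0//.
exact: d_le.
Qed.

End Instability.

(** * Decay along a sequence from square integrability *)

Section WeightedL2.
Context {R : realType}.
Implicit Types (gamma a c x : R) (f F : R -> R).

Local Notation mu := (@lebesgue_measure R).

Lemma measurable_expRN_potential gamma :
  measurable_fun [set: R] (fun x => expR (- potential gamma x)).
Proof.
apply: measurableT_comp => //; apply: measurableT_comp => //.
apply: measurable_funM => //.
exact: (measurableT_comp (measurable_powR (gamma + 1))).
Qed.

Lemma integrable_inv_oneDsqr :
  mu.-integrable [set: R] (fun x => ((oneDsqr x)^-1)%:E).
Proof.
have oneDsqrV_ge0 (x : R) : 0 <= (oneDsqr x)^-1 by rewrite invr_ge0 ltW ?oneDsqr_gt0.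
apply/integrableP; split.
  apply/measurable_EFinP; apply: continuous_measurable_fun.
  exact: continuous_oneDsqrV.
under eq_integral do rewrite gee0_abs ?lee_fin//.
rewrite ge0_symfun_integralT//; first last.
- by move=> x /=; rewrite /oneDsqr sqrrN.
- exact: continuous_oneDsqrV.
have -> : [set x : R | 0 <= x] = `[0, +oo[ by rewrite set_itvcy.
by rewrite integral0y_oneDsqr -EFinM ltry.
Qed.

(** Domination by an integrable function valid for every gamma > 0, even when
    the potential grows more slowly than a quadratic one. *)
Lemma expRN_potential_le gamma : 0 < gamma ->
  exists C : R, forall x, expR (- potential gamma x) <= C * (oneDsqr x)^-1.
Proof.
move=> gamma_gt0.
have [|Y0 Yexp] := @expR_dominates_square R 1 (gamma + 1)^-1 ltr01.
  by rewrite invr_gt0 addr_gt0.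
pose Y := Num.max Y0 1.
have Y_ge1 : 1 <= Y by rewrite /Y le_max lexx orbT.
have Y0Y : Y0 <= Y by rewrite /Y le_max lexx.
exists (2 + Y ^+ 2) => x.
rewrite ler_pdivlMr ?oneDsqr_gt0// /oneDsqr mulrDr mulr1.
have V_ge0 : 0 <= potential gamma x.
  by rewrite mulr_ge0 ?powR_ge0// invr_ge0 addr_ge0// ltW.
have e_le1 : expR (- potential gamma x) <= 1 by rewrite -expR0 ler_expR oppr_le0.
have e_ge0 := expR_ge0 (- potential gamma x).
have [xY|Yx] := leP `|x| Y.
- have x2 : x ^+ 2 <= Y ^+ 2.
    by rewrite -(real_normK (num_real x)) lerXn2r ?nnegrE// (le_trans ler01).
  have := sqr_ge0 x; nra.
- have xle : `|x| <= `|x| `^ (gamma + 1).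
    rewrite -{1}(powRr1 (normr_ge0 x)) ler_powR//; first by lra.
    by rewrite lerDr ltW.
  have := Yexp _ (ltW (le_lt_trans Y0Y (lt_le_trans Yx xle))).
  rewrite -/(potential gamma x) mul1r => lt_e.
  have x2 : x ^+ 2 <= expR (potential gamma x).
    apply: le_trans (ltW lt_e); rewrite -(real_normK (num_real x)).
    by rewrite lerXn2r ?nnegrE ?powR_ge0.
  have : expR (- potential gamma x) * x ^+ 2 <= 1.
    by rewrite expRN mulrC ler_pdivrMr ?expR_gt0// mul1r.
  have := sqr_ge0 Y; lra.
Qed.

Lemma integrable_expRN_potential gamma : 0 < gamma ->
  mu.-integrable [set: R] (fun x => (expR (- potential gamma x))%:E).
Proof.
move=> gamma_gt0; have [C leC] := expRN_potential_le gamma_gt0.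
have := @integrableZl _ _ _ mu setT measurableT C _ integrable_inv_oneDsqr.
apply: le_integrable => //.
- by apply/measurable_EFinP; exact: measurable_expRN_potential.
- move=> x _; rewrite -EFinM !abse_EFin lee_fin ger0_norm ?expR_ge0//.
  by rewrite (le_trans (leC x))// ler_norm.
Qed.

Lemma partition_function_gt0 gamma : 0 < gamma ->
  0 < \int[mu]_y expR (- potential gamma y).
Proof.
move=> gamma_gt0; have intV := integrable_expRN_potential gamma_gt0.
rewrite /Rintegral fine_gt0//.
have := integrable_fin_num measurableT intV; rewrite fin_numElt => /andP[_ ->].
rewrite andbT; apply: (@lt_le_trans _ _
  (\int[mu]_(x in `[0%R, 1%R]) (expR (- (gamma + 1)^-1))%:E)%E).
  rewrite integral_cst//= lebesgue_measure_itv/= lte_fin ltr01 sube0 mule1.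
  by rewrite lte_fin expR_gt0.
apply: (@le_trans _ _ (\int[mu]_(x in `[0%R, 1%R]) (expR (- potential gamma x))%:E)%E); last first.
  apply: ge0_subset_integral => //.
  by apply/measurable_EFinP; exact: measurable_expRN_potential.
apply: ge0_le_integral => //.
- by apply/measurable_EFinP; apply: measurable_funTS; exact: measurable_expRN_potential.
- move=> x /=; rewrite in_itv/= => /andP[x0 x1].
  rewrite lee_fin ler_expR lerN2 /potential ger0_norm//.
  rewrite ger_pMr ?invr_gt0 ?addr_gt0//.
  have g1_ge0 : 0 <= gamma + 1 by rewrite addr_ge0// ltW.
  by rewrite (le_trans (ge0_ler_powR g1_ge0 _ _ x1)) ?nnegrE// powR1.
Qed.

Lemma integrable_half_line_lt F a c : mu.-integrable [set: R] (EFin \o F) ->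
  0 < c -> exists2 x, a <= x & F x < c.
Proof.
move=> intF c_gt0; apply: contrapT => /forall2NP Fc.
have {}Fc x : a <= x -> c <= F x.
  by move=> ax; have [|/negP] := Fc x; [rewrite ax|rewrite -leNgt].
have : mu.-integrable `[a, +oo[ (cst c%:E).
  apply: (@le_integrable _ _ _ mu _ _ (cst c%:E) (EFin \o F)) => //.
  - move=> x /=; rewrite in_itv/= andbT => ax.
    by rewrite lee_fin ger0_norm ?(ltW c_gt0)// (le_trans (Fc _ ax)) ?ler_norm.
  - exact: integrableS intF.
move/integrableP => -[_].
under eq_integral do rewrite /cst abse_EFin.
rewrite integral_cst//= lebesgue_measure_itv/= ltry.
by rewrite ger0_norm ?(ltW c_gt0)// addye// mulry gtr0_sg// mul1e ltxx.
Qed.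

(** The normalising constant of the density is a finite positive number, so
    integrability against the density is integrability against exp(-V). *)
Lemma in_L2_decay gamma u a c : 0 < gamma -> in_L2 (density (potential gamma)) u ->
  0 < c -> exists2 x, a <= x & u x ^+ 2 * expR (- potential gamma x) < c.
Proof.
move=> gamma_gt0 [_ intu] c_gt0; have Z_gt0 := partition_function_gt0 gamma_gt0.
have [|x ax] := @integrable_half_line_lt _ a
  ((\int[mu]_y expR (- potential gamma y))^-1 * c) intu.
  by rewrite mulr_gt0// invr_gt0.
by rewrite /density mulrCA ltr_pM2l ?invr_gt0// => ?; exists x.
Qed.

End WeightedL2.

(** * The potential, and uniqueness for the Cauchy problem *)

Section Eigenfunction.
Context {R : realType}.
Implicit Types (gamma lambda a x y xs : R) (u p : R -> R).

Lemma is_derive_potential gamma x : 0 < gamma -> 0 < x ->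
  is_derive x 1 (potential gamma) (x `^ gamma).
Proof.
move=> gamma_gt0 x_gt0; have g1 : gamma + 1 != 0 by rewrite gt_eqF// addr_gt0.
have := is_derive_scale (gamma + 1)^-1 (is_derive_powR (gamma + 1) x_gt0).
rewrite addrK mulrA mulVf// mul1r; apply: is_derive_near_right x_gt0 _ => y y_gt0.
by rewrite /potential gtr0_norm.
Qed.

Lemma is_derive_potentialN gamma x : 0 < gamma -> x < 0 ->
  is_derive x 1 (potential gamma) (- (- x) `^ gamma).
Proof.
move=> gamma_gt0 x_lt0; have Nx_gt0 : 0 < - x by rewrite oppr_gt0.
have := is_derive_chain (is_derive_potential gamma_gt0 Nx_gt0)
  (is_derive_opp (is_derive_id x 1)).
by rewrite mulrN1; under eq_fun do rewrite /potential normrN.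
Qed.

Lemma derive1_potential gamma x : 0 < gamma -> 0 < x ->
  derive1 (potential gamma) x = x `^ gamma.
Proof.
by move=> g_gt0 x_gt0; rewrite derive1E; have [_ ->] := is_derive_potential g_gt0 x_gt0.
Qed.

Lemma derive1n2_potential gamma x : 0 < gamma -> 0 < x ->
  derive1n 2 (potential gamma) x = gamma * x `^ (gamma - 1).
Proof.
move=> g_gt0 x_gt0; rewrite /derive1n/= derive1E; apply: derive_val.
apply: (is_derive_near_right x_gt0 _ (is_derive_powR gamma x_gt0)) => y y_gt0.
by rewrite derive1_potential.
Qed.

Lemma derive1_potential_bounded gamma a : 0 < gamma ->
  exists M : R, forall x, `|x| <= a -> `|derive1 (potential gamma) x| <= M.
Proof.
(* The value at 0 is absorbed in the bound, whatever it is. *)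
move=> g_gt0; exists (`|derive1 (potential gamma) 0| + a `^ gamma) => x xa.
have [x_lt0|x_gt0|->] := ltgtP x 0; last by rewrite lerDl powR_ge0.
- rewrite derive1E; have [_ ->] := is_derive_potentialN g_gt0 x_lt0.
  rewrite normrN ger0_norm ?powR_ge0// -ltr0_norm//.
  rewrite (le_trans (ge0_ler_powR (ltW g_gt0) _ _ xa)) ?nnegrE//.
    exact: le_trans xa.
  by rewrite lerDr.
- rewrite derive1_potential// ger0_norm ?powR_ge0// -{1}(gtr0_norm x_gt0).
  rewrite (le_trans (ge0_ler_powR (ltW g_gt0) _ _ xa)) ?nnegrE//.
    exact: le_trans xa.
  by rewrite lerDr.
Qed.

(** Energy estimate: the derivative of u^2 + u'^2 is bounded by a multiple of
    u^2 + u'^2 on bounded sets, so this quantity times exp(L x), or exp(-L x),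
    is monotone there and stays 0. *)
Lemma linear_ode_unique p lambda (u u1 : R -> R) y :
  (forall a, exists M : R, forall x, `|x| <= a -> `|p x| <= M) ->
  (forall x, is_derive x 1 u (u1 x)) ->
  (forall x, is_derive x 1 u1 (p x * u1 x - lambda * u x)) ->
  u y = 0 -> u1 y = 0 -> forall x, u x = 0.
Proof.
move=> p_bnd uD u1D uy0 u1y0 x.
pose a : R := Num.max `|x| `|y|.
have [xa ya] : `|x| <= a /\ `|y| <= a by rewrite /a !le_max !lexx orbT.
have [M pM] := p_bnd a.
have xM (z : R) : (x <= z <= y) || (y <= z <= x) -> `|p z| <= M.
  move=> xzy; apply: pM; rewrite ler_norml.
  have := ler_norm x; have := ler_norm (- x); have := ler_norm y; have := ler_norm (- y).
  rewrite !normrN; case/orP: xzy => /andP[] *; lra.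
pose L := 1 + `|lambda| + 2 * M.
pose E z := u z * u z + u1 z * u1 z.
pose dE z := (u1 z * u z + u z * u1 z) +
  ((p z * u1 z - lambda * u z) * u1 z + u1 z * (p z * u1 z - lambda * u z)).
have ED (z : R) : is_derive z 1 E (dE z).
  by apply: is_derive_add; apply: is_derive_mul.
have dE_le (z : R) : `|p z| <= M -> `|dE z| <= L * E z.
  move=> pzM.
  have -> : dE z = 2 * (1 - lambda) * (u z * u1 z) + 2 * p z * (u1 z) ^+ 2.
    by rewrite /dE; ring.
  rewrite (le_trans (ler_normD _ _))//.
  have -> : `|2 * (1 - lambda) * (u z * u1 z)| = `|1 - lambda| * (2 * (`|u z| * `|u1 z|)).
    by rewrite !normrM (@ger0_norm _ 2)//; ring.
  have -> : `|2 * p z * u1 z ^+ 2| = 2 * (`|p z| * u1 z ^+ 2).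
    by rewrite normrM (ger0_norm (sqr_ge0 _)) normrM (@ger0_norm _ 2)//; ring.
  have h1 : `|1 - lambda| <= 1 + `|lambda|.
    by rewrite (le_trans (ler_normB _ _))// normr1.
  have h2 : 2 * (`|u z| * `|u1 z|) <= E z.
    rewrite /E -!expr2 -(real_normK (num_real (u z))) -(real_normK (num_real (u1 z))).
    have := sqr_ge0 (`|u z| - `|u1 z|); lra.
  have h3 : u1 z ^+ 2 <= E z by rewrite /E -expr2; have := sqr_ge0 (u z); lra.
  have h4 : `|1 - lambda| * (2 * (`|u z| * `|u1 z|)) <= (1 + `|lambda|) * E z.
    by apply: ler_pM => //; rewrite mulr_ge0// mulr_ge0.
  have h5 : `|p z| * u1 z ^+ 2 <= M * E z by apply: ler_pM => //; exact: sqr_ge0.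
  by rewrite /L; lra.
have E_ge0 z : 0 <= E z by rewrite addr_ge0// -expr2 sqr_ge0.
have Ey0 : E y = 0 by rewrite /E uy0 u1y0 mulr0 addr0.
suff Ex0 : E x = 0.
  apply/eqP; move/eqP: Ex0; rewrite /E paddr_eq0 -?expr2 ?sqr_ge0//.
  by rewrite !sqrf_eq0 => /andP[].
apply/eqP; rewrite eq_le E_ge0 andbT.
have [xy|/ltW yx] := leP x y.
- pose g z := E z * expR (L * z).
  have gD (z : R) : is_derive z 1 g (dE z * expR (L * z) + E z * (expR (L * z) * L)).
    apply: is_derive_mul => //; apply: is_derive_expR_comp.
    by have := is_derive_scale L (is_derive_id z 1); rewrite mulr1.
  have : g x <= g y.
    apply: (le_of_derive_ge0 (fun z _ _ => gD z)) => // z xz zy.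
    have := @dE_le z; rewrite xM ?xz ?zy// => /(_ isT); rewrite ler_norml => /andP[h _].
    have -> : dE z * expR (L * z) + E z * (expR (L * z) * L) =
        (dE z + L * E z) * expR (L * z) by ring.
    by rewrite mulr_ge0 ?expR_ge0// -(lerD2l (- (L * E z))) addr0 addrCA addNr addr0.
  by rewrite /g Ey0 mul0r pmulr_lle0 ?expR_gt0.
- pose g z := - (E z * expR (- (L * z))).
  have gD (z : R) : is_derive z 1 g (- (dE z * expR (- (L * z)) + E z * (expR (- (L * z)) * - L))).
    apply: is_derive_opp; apply: is_derive_mul => //; apply: is_derive_expR_comp.
    apply: is_derive_opp.
    by have := is_derive_scale L (is_derive_id z 1); rewrite mulr1.
  have : g y <= g x.
    apply: (le_of_derive_ge0 (fun z _ _ => gD z)) => // z yz zx.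
    have := @dE_le z; rewrite xM ?yz ?zx ?orbT// => /(_ isT); rewrite ler_norml => /andP[_ h].
    have -> : - (dE z * expR (- (L * z)) + E z * (expR (- (L * z)) * - L)) =
        (L * E z - dE z) * expR (- (L * z)) by ring.
    by rewrite mulr_ge0 ?expR_ge0// subr_ge0.
  by rewrite /g Ey0 mul0r lerN2 pmulr_lle0 ?expR_gt0.
Qed.

End Eigenfunction.

(** * Signs of the eigenfunction and its derivative *)

Section Positivity.
Context {R : realType} (gamma lambda xs : R) (u : R -> R).
Hypotheses (gamma_gt0 : 0 < gamma) (lambda_gt0 : 0 < lambda).
Hypothesis u_eig : ode_eigenfunction (potential gamma) lambda u.
Hypothesis xs_turning : turning_point (potential gamma) lambda xs.
Hypothesis u_xs_ge0 : 0 <= u xs.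

Implicit Types x y : R.

Local Notation V := (potential gamma).
Local Notation u1 := (derive1 u).

Let xs_gt0 : 0 < xs. Proof. by case: xs_turning. Qed.

Lemma eigenfunction_derive x : is_derive x 1 u (u1 x).
Proof.
by have [[uD _ _] _ _] := u_eig; rewrite derive1E; exact/derivableP.
Qed.

Lemma eigenfunction_derive2 x :
  is_derive x 1 u1 (derive1 V x * u1 x - lambda * u x).
Proof.
have [[_ u1D ode] _ _] := u_eig.
have -> : derive1 V x * u1 x - lambda * u x = derive1 u1 x.
  by rewrite -ode opprD opprK addrCA subrr addr0.
by rewrite derive1E; exact/derivableP.
Qed.

Lemma turning_point_ge0 x : xs <= x ->
  0 <= (x `^ gamma) ^+ 2 / 4 - gamma * x `^ (gamma - 1) / 2 - lambda.
Proof.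
case: xs_turning => _ _ T_ge0 xsx; have := T_ge0 x xsx.
have x_gt0 : 0 < x := lt_le_trans xs_gt0 xsx.
by rewrite /Tfun derive1_potential// derive1n2_potential// ger0_norm// powR_ge0.
Qed.

(* H = w^2 and G = w w' for w = u exp(-V/2). *)
Let H x := u x * u x * expR (- V x).
Let G x := u x * (u1 x - x `^ gamma / 2 * u x) * expR (- V x).

Let H_derive x : 0 < x -> is_derive x 1 H (2 * G x).
Proof.
move=> x_gt0; have uD := eigenfunction_derive x.
have := is_derive_mul (is_derive_mul uD uD)
  (is_derive_expR_comp (is_derive_opp (is_derive_potential gamma_gt0 x_gt0))).
by move=> /is_derive_eq; apply; rewrite /G; field.
Qed.

Let dG x := ((u1 x - x `^ gamma / 2 * u x) ^+ 2
    + ((x `^ gamma) ^+ 2 / 4 - gamma * x `^ (gamma - 1) / 2 - lambda) * u x ^+ 2)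
   * expR (- V x).

(** This is (w w')' = w'^2 + T w^2 for w = u exp(-V/2), the solution of the
    Schroedinger equation w'' = T w. *)
Let G_derive x : 0 < x -> is_derive x 1 G (dG x).
Proof.
move=> x_gt0; have uD := eigenfunction_derive x.
have fuD := is_derive_scale 2^-1 (is_derive_mul (is_derive_powR gamma x_gt0) uD).
have := is_derive_mul
  (is_derive_mul uD (is_derive_add (eigenfunction_derive2 x) (is_derive_opp fuD)))
  (is_derive_expR_comp (is_derive_opp (is_derive_potential gamma_gt0 x_gt0))).
rewrite derive1_potential// (_ : (fun _ => _) = G); last first.
  by apply/funext => y; rewrite /G; field.
by move=> /is_derive_eq; apply; rewrite /dG; field.
Qed.

(** Otherwise w^2 would be bounded below by a positive constant on a half-line,
    against the integrability of w^2. *)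
Let G_le0 x : xs <= x -> G x <= 0.
Proof.
have pos y : xs <= y -> 0 < y := lt_le_trans xs_gt0.
move=> xsx; rewrite leNgt; apply/negP => Gx_gt0.
have dG_ge0 y : xs <= y -> 0 <= dG y.
  move=> xsy; apply: mulr_ge0; last exact: expR_ge0.
  apply: addr_ge0; first exact: sqr_ge0.
  by apply: mulr_ge0; [exact: turning_point_ge0|exact: sqr_ge0].
have G_gt0 y : x <= y -> 0 <= 2 * G y.
  move=> xy; apply: mulr_ge0; first exact: ler0n.
  apply: (le_trans (ltW Gx_gt0)).
  exact: (nondecreasing_of_derive_ge0 (fun z xsz => G_derive (pos z xsz)) dG_ge0 xsx xy).
have ux_neq0 : u x != 0.
  by apply: contraTneq Gx_gt0 => ux0; rewrite /G ux0 !mul0r ltxx.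
have Hx_gt0 : 0 < H x by rewrite mulr_gt0 ?expR_gt0// -expr2 exprn_even_gt0.
have [_ uL2 _] := u_eig.
have [y xy] := @in_L2_decay _ _ _ x _ gamma_gt0 uL2 Hx_gt0.
apply/negP; rewrite -leNgt expr2.
exact: (nondecreasing_of_derive_ge0 (a := x)
  (fun z xz => H_derive (pos z (le_trans xsx xz))) G_gt0 (lexx x) xy).
Qed.

(** From a zero x on, w^2 is nonnegative, nonincreasing and vanishes at x, so u
    vanishes on a half-line, hence everywhere. *)
Let u_neq0 x : xs <= x -> u x != 0.
Proof.
move=> xsx; apply/eqP => ux0.
have H0 y : x <= y -> u y = 0.
  move=> xy; have : H y <= H x.
    apply: (nonincreasing_of_derive_le0 (a := x) _ _ _ xy) => // z xz.
      by apply: H_derive; rewrite (lt_le_trans xs_gt0)// (le_trans xsx).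
    by rewrite pmulr_rle0// G_le0// (le_trans xsx).
  rewrite /H ux0 !mul0r pmulr_lle0 ?expR_gt0// -expr2 => u2_le0.
  by apply/eqP; rewrite -sqrf_eq0 eq_le u2_le0 sqr_ge0.
have xx1 : x < x + 1 by rewrite ltrDl.
have u1_0 : u1 (x + 1) = 0.
  rewrite derive1E; apply: derive_val.
  apply: (is_derive_near_right xx1 _ (is_derive_cst 0 (x + 1) 1)) => y xy.
  by rewrite H0// ltW.
have [_ _ [y /eqP]] := u_eig; apply.
apply: (linear_ode_unique (p := derive1 V) (lambda := lambda) _ _ _ (H0 _ (ltW xx1)) u1_0).
- by move=> a; exact: derive1_potential_bounded.
- exact: eigenfunction_derive.
- exact: eigenfunction_derive2.
Qed.

Lemma eigenfunction_gt0 x : xs <= x -> 0 < u x.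
Proof.
move=> xsx; rewrite ltNge; apply/negP => ux_le0.
have [||y] := @IVT R u xs x 0 xsx.
- apply: continuous_subspaceT => y; exact: is_derive_continuous (eigenfunction_derive y).
- by rewrite ge_min ux_le0 orbT le_max u_xs_ge0.
by rewrite in_itv/= => /andP[xsy _] uy0; have := u_neq0 xsy; rewrite uy0 eqxx.
Qed.

Lemma eigenfunction_derive_le x : xs <= x -> u1 x <= x `^ gamma / 2 * u x.
Proof.
move=> xsx; have := G_le0 xsx; rewrite /G pmulr_lle0 ?expR_gt0//.
by rewrite pmulr_rle0 ?eigenfunction_gt0// subr_le0.
Qed.

(** The function u' exp(-V) decreases, as u > 0; once u' <= 0, u' would thus stay
    below a negative constant and u would reach 0. *)
Lemma eigenfunction_derive_gt0 x : xs <= x -> 0 < u1 x.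
Proof.
move=> xsx; rewrite ltNge; apply/negP => u1x_le0.
pose K y := u1 y * expR (- V y).
have KD y : x <= y -> is_derive y 1 K (- (lambda * u y * expR (- V y))).
  move=> xy; have y_gt0 : 0 < y by rewrite (lt_le_trans xs_gt0)// (le_trans xsx).
  have := is_derive_mul (eigenfunction_derive2 y)
    (is_derive_expR_comp (is_derive_opp (is_derive_potential gamma_gt0 y_gt0))).
  by rewrite derive1_potential//; move=> /is_derive_eq; apply; ring.
have K_lt0 y : x <= y -> - (lambda * u y * expR (- V y)) < 0.
  move=> xy; rewrite oppr_lt0 mulr_gt0 ?expR_gt0// mulr_gt0//.
  by rewrite eigenfunction_gt0// (le_trans xsx).
have K_decr := decreasing_of_derive_lt0 KD K_lt0.
pose x1 := x + 1; have xx1 : x < x1 by rewrite ltrDl.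
have Kx1 : K x1 < 0.
  by rewrite (lt_le_trans (K_decr _ _ (lexx x) xx1))// mulr_le0_ge0// expR_ge0.
have u1_le y : x1 <= y -> u1 y <= K x1.
  move=> x1y; have Ky : K y <= K x1.
    move: x1y; rewrite le_eqVlt => /predU1P[->//|x1y].
    by rewrite ltW// K_decr// ltW.
  have V_ge0 : 0 <= V y by rewrite mulr_ge0 ?powR_ge0// invr_ge0 addr_ge0// ltW.
  have u1y : u1 y <= 0.
    have : K y < 0 by exact: le_lt_trans Ky Kx1.
    by rewrite /K pmulr_llt0 ?expR_gt0// => /ltW.
  apply: le_trans Ky; rewrite /K -{1}(mulr1 (u1 y)) ler_wnM2l//.
  by rewrite -expR0 ler_expR oppr_le0.
pose g y := u y - K x1 * y.
have gD y : x1 <= y -> is_derive y 1 g (u1 y - K x1).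
  move=> _; apply: is_derive_add; first exact: eigenfunction_derive.
  by apply: is_derive_opp; have := is_derive_scale (K x1) (is_derive_id y 1); rewrite mulr1.
pose y := x1 - u x1 / K x1.
have ux1 : 0 < u x1 by rewrite eigenfunction_gt0// (le_trans xsx)// ltW.
have x1y : x1 <= y by rewrite /y lerDl -mulrN mulr_ge0 ?(ltW ux1)// oppr_ge0 invr_le0 ltW.
have : g y <= g x1.
  apply: (nonincreasing_of_derive_le0 gD) => // z x1z.
  by rewrite subr_le0 u1_le.
rewrite /g /y mulrBr mulrCA divff ?lt_eqF// mulr1 => guy.
have : 0 < u (x1 - u x1 / K x1).
  by rewrite eigenfunction_gt0// (le_trans _ x1y)// (le_trans xsx)// ltW.
lra.
Qed.

Lemma is_derive_log_derivative x : xs <= x ->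
  is_derive x 1 (fun y => u1 y / u y)
    (x `^ gamma * (u1 x / u x) - lambda - (u1 x / u x) ^+ 2).
Proof.
move=> xsx; have ux_neq0 : u x != 0 by rewrite gt_eqF// eigenfunction_gt0.
have := is_derive_mul (eigenfunction_derive2 x)
  (is_deriveV ux_neq0 (eigenfunction_derive x)).
rewrite derive1_potential//; last exact: lt_le_trans xsx.
by move=> /is_derive_eq; apply; rewrite /GRing.scale/=; field.
Qed.

Lemma is_derive_ln_eigenfunction x : xs <= x ->
  is_derive x 1 (fun y => ln (u y)) (u1 x / u x).
Proof.
move=> xsx; have ux_gt0 := eigenfunction_gt0 xsx.
rewrite mulrC; apply: is_derive_chain (eigenfunction_derive x).
exact: is_derive1_ln.
Qed.

End Positivity.

(** * From a formal expansion of u'/u to u *)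

Section Asymptotics.
Context {R : realType}.

(** Grouping the products by total degree k = i + j: for k <= N they form the
    convolutions of the recursion, and they cancel in the residual. *)
Lemma sqr_sum_convolution (q : nat -> R) (N : nat) :
  (\sum_(1 <= i < N.+1) q i) ^+ 2 =
  \sum_(2 <= k < N.+1) \sum_(1 <= j < k) q j * q (k - j)%N +
  \sum_(1 <= i < N.+1) \sum_(1 <= j < N.+1 | (N < i + j)%N) q i * q j.
Proof.
have -> : \sum_(2 <= k < N.+1) \sum_(1 <= j < k) q j * q (k - j)%N =
    \sum_(1 <= i < N.+1) \sum_(1 <= j < N.+1 | ~~ (N < i + j)%N) q i * q j.
  under eq_big_nat => k /andP[_ kN].
    rewrite (@big_nat_widen _ _ _ _ _ N.+1) 1?ltnW//.
    over.
  rewrite (exchange_big_dep_nat predT)//=.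
  apply: eq_big_nat => i /andP[i_ge1 iN].
  transitivity (\sum_(1 + i <= k < N.+1) q i * q (k - i)%N).
    by rewrite [RHS](@big_nat_widenl _ _ _ (1 + i) 2) ?(leq_add2l 1 1 i).
  rewrite big_addn; under eq_bigr do rewrite addnK.
  rewrite (@big_nat_widen _ _ _ _ _ N.+1) ?leq_subr//.
  apply: eq_bigl => j /=; rewrite -leqNgt ltn_subRL.
  by rewrite ltnS.
rewrite expr2 big_distrlr/= -big_split/=; apply: eq_bigr => i _.
by rewrite [LHS](bigID (fun j => (N < i + j)%N))/= addrC.
Qed.

Lemma powR_tends_pinfty (g K : R) : 0 < g -> 0 <= K ->
  exists X : R, forall x, X <= x -> K <= x `^ g.
Proof.
move=> g_gt0 K_ge0; exists (K `^ g^-1) => x Xx.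
rewrite -[leLHS](powRr1 K_ge0) -(mulVf (lt0r_neq0 g_gt0)) powRrM.
rewrite ge0_ler_powR ?nnegrE ?powR_ge0//; first exact: ltW.
by rewrite (le_trans _ Xx)// powR_ge0.
Qed.

(** With W an antiderivative of -K x^(-p) that tends to 0, g + W is nonincreasing
    and g - W nondecreasing on [X, +oo[; on [a, X] continuity suffices. *)
Lemma bounded_of_derive_decay (g dg : R -> R) (a X K p : R) :
  0 < X -> a <= X -> 1 < p -> 0 <= K ->
  {within `[a, X], continuous g} ->
  (forall x, X <= x -> is_derive x 1 g (dg x)) ->
  (forall x, X <= x -> `|dg x| <= K * x `^ (- p)) ->
  exists L : R, forall x, a <= x -> `|g x| <= L.
Proof.
move=> X_gt0 aX p_gt1 K_ge0 g_cont gD dg_le.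
have [M _ gM] := EVT_max aX g_cont.
have [m _ gm] := EVT_min aX g_cont.
pose W x := K / (p - 1) * x `^ (1 - p).
have WD x : X <= x -> is_derive x 1 W (- (K * x `^ (- p))).
  move=> Xx; have := is_derive_scale (K / (p - 1)) (is_derive_powR (1 - p) (lt_le_trans X_gt0 Xx)).
  move/is_derive_eq; apply; rewrite addrAC subrr add0r; field; lra.
have W_ge0 x : 0 <= W x.
  by rewrite mulr_ge0 ?powR_ge0// divr_ge0// subr_ge0 ltW.
have g_upper x : X <= x -> g x <= g X + W X.
  move=> Xx; have : g x + W x <= g X + W X.
    apply: (nonincreasing_of_derive_le0
      (fun z Xz => is_derive_add (gD z Xz) (WD z Xz))) Xx => // z Xz.
    by rewrite subr_le0 (le_trans _ (dg_le _ Xz))// ler_norm.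
  by have := W_ge0 x; lra.
have g_lower x : X <= x -> g X - W X <= g x.
  move=> Xx; have : g X - W X <= g x - W x.
    apply: (nondecreasing_of_derive_ge0
      (fun z Xz => is_derive_add (gD z Xz) (is_derive_opp (WD z Xz)))) Xx => // z Xz.
    have := dg_le _ Xz; rewrite ler_norml; lra.
  by have := W_ge0 x; lra.
exists (`|g M| + `|g m| + `|g X| + W X) => x ax.
have [xX|/ltW Xx] := leP x X.
- have xaX : x \in `[a, X]%R by rewrite in_itv/= ax.
  have := gM _ xaX; have := gm _ xaX; have := W_ge0 X.
  have := ler_norm (g M); have := ler_norm (- g m); have := normr_ge0 (g X).
  have := normr_ge0 (g M); have := normr_ge0 (g m).
  rewrite normrN ler_norml; lra.
- have := g_upper _ Xx; have := g_lower _ Xx.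
  have := ler_norm (g X); have := ler_norm (- g X).
  have := normr_ge0 (g M); have := normr_ge0 (g m).
  rewrite normrN ler_norml; lra.
Qed.

End Asymptotics.

Section RiccatiExpansion.
Context {R : realType} (gamma lambda xs : R) (u : R -> R).
Hypotheses (gamma_gt0 : 0 < gamma) (lambda_gt0 : 0 < lambda).
Hypothesis u_eig : ode_eigenfunction (potential gamma) lambda u.
Hypothesis xs_turning : turning_point (potential gamma) lambda xs.
Hypothesis u_xs_ge0 : 0 <= u xs.

Local Notation u1 := (derive1 u).

Let xs_gt0 : 0 < xs. Proof. by case: xs_turning. Qed.

(** Order of the k-th term: either products only, with exponent -(2k-1)gamma, or
    at least one differentiation, with exponent at most -(1+2 gamma). *)
Definition term_order (k : nat) : R :=
  Num.max (- ((2 * k%:R - 1) * gamma)) (- (1 + 2 * gamma)).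

Variables (N : nat) (q rem : nat -> R -> R).
Hypothesis N_gt0 : (0 < N)%N.
Hypothesis N_large : 1 < (2 * N%:R + 1) * gamma.
Hypothesis q_sum : forall k, (1 <= k <= N)%N -> power_sum xs (term_order k) (q k).
Hypothesis rem_sum :
  forall k, (2 <= k <= N)%N -> power_sum xs (- (1 + gamma)) (rem k).
Hypothesis q_one : forall x, xs < x -> x `^ gamma * q 1%N x = lambda.
Hypothesis q_rec : forall k, (2 <= k <= N)%N -> forall x, xs < x ->
  x `^ gamma * q k x = \sum_(1 <= j < k) q j x * q (k - j)%N x + rem k x.

Let P x := \sum_(1 <= k < N.+1) q k x.

Let P_sum : power_sum xs (- gamma) P.
Proof.
apply: power_sum_sum => k; rewrite mem_index_iota ltnS => kN _.
apply: power_sumW (q_sum kN); have /andP[k_ge1 _] := kN.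
have : 1 <= k%:R :> R by rewrite ler1n.
have g_gt0 := gamma_gt0.
rewrite /term_order ge_max !lerN2 => k1; apply/andP; split; last by lra.
by rewrite -[leLHS]mul1r ler_wpM2r//; lra.
Qed.

(** The residual of the truncated expansion in the Riccati equation is what the
    recursion leaves over: its remainders, the products of degree above N, and
    the derivative of the sum. *)
Let residual_sum (dP : R -> R) : power_sum xs (- gamma - 1) dP ->
  power_sum xs (gamma - Num.min ((2 * N%:R + 1) * gamma) (1 + 2 * gamma))
    (fun x => x `^ gamma * P x - lambda - P x ^+ 2 - dP x).
Proof.
move=> dP_sum; have g_gt0 := gamma_gt0.
pose E x := \sum_(2 <= k < N.+1) rem k x -
  \sum_(1 <= i < N.+1) \sum_(1 <= j < N.+1 | (N < i + j)%N) q i x * q j x - dP x.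
apply: (@power_sum_eq _ _ _ E); last first.
  move=> x xsx; rewrite /E /P sqr_sum_convolution mulr_sumr.
  rewrite big_nat_recl// q_one//.
  have -> : \sum_(1 <= i < N) x `^ gamma * q i.+1 x =
      \sum_(2 <= k < N.+1) (\sum_(1 <= j < k) q j x * q (k - j)%N x + rem k x).
    rewrite [RHS]big_add1/=; apply: eq_big_nat => i /andP[i_ge1 iN].
    by rewrite q_rec//= ltnS i_ge1.
  by rewrite big_split/=; ring.
have N_ge1 : 1 <= N%:R :> R by rewrite ler1n.
have order1 : - (1 + gamma) <= gamma - Num.min ((2 * N%:R + 1) * gamma) (1 + 2 * gamma).
  have : Num.min ((2 * N%:R + 1) * gamma) (1 + 2 * gamma) <= 1 + 2 * gamma.
    by rewrite ge_min lexx orbT.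
  by lra.
apply: power_sumD; last first.
  by apply: power_sumN; apply: power_sumW dP_sum; lra.
apply: power_sumD.
  apply: power_sum_sum => k; rewrite mem_index_iota ltnS => kN _.
  exact: power_sumW order1 (rem_sum kN).
apply: power_sumN; apply: power_sum_sum => i; rewrite mem_index_iota ltnS => iN _.
apply: power_sum_sum => j; rewrite mem_index_iota ltnS => jN Nij.
apply: power_sumW (power_sumM (ltW xs_gt0) (q_sum iN) (q_sum jN)).
have ij_ge : N%:R + 1 <= i%:R + j%:R :> R by rewrite -natrD -[1]/(1%:R) -natrD ler_nat addn1.
have ijg : (N%:R + 1) * gamma <= (i%:R + j%:R) * gamma by rewrite ler_wpM2r// ltW.
have /andP[i_ge1 _] := iN; have /andP[j_ge1 _] := jN.
have ig : gamma <= i%:R * gamma by rewrite -[leLHS]mul1r ler_wpM2r ?ler1n// ltW.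
have jg : gamma <= j%:R * gamma by rewrite -[leLHS]mul1r ler_wpM2r ?ler1n// ltW.
rewrite /term_order.
case: (leP ((2 * N%:R + 1) * gamma) (1 + 2 * gamma));
case: (leP (- ((2 * i%:R - 1) * gamma)) (- (1 + 2 * gamma)));
case: (leP (- ((2 * j%:R - 1) * gamma)) (- (1 + 2 * gamma))); lra.
Qed.

(** The error d = v - P satisfies d' = (f - v - P) d + r, with r the residual, and
    |d| <= f because 0 < v <= f/2; so instability applies. *)
Lemma log_derivative_expansion : exists X K p : R,
  [/\ 1 <= X, xs < X, 1 < p, 0 < K &
  forall x, X <= x -> `|u1 x / u x - P x| <= K * x `^ (- p)].
Proof.
have g_gt0 := gamma_gt0.
have [dP dP_sum PD] := power_sum_derive (ltW xs_gt0) P_sum.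
pose p := Num.min ((2 * N%:R + 1) * gamma) (1 + 2 * gamma).
have p_gt1 : 1 < p by rewrite lt_min N_large ltrDl mulr_gt0.
pose r x := x `^ gamma * P x - lambda - P x ^+ 2 - dP x.
have [K1 K1_gt0 r_le] := power_sum_bound (residual_sum dP_sum).
have [K2 K2_gt0 P_le] := power_sum_bound P_sum.
have [X2 X2_le] : exists X : R, forall x, X <= x -> 4 * K2 <= x `^ (gamma + gamma).
  by apply: powR_tends_pinfty; [exact: addr_gt0|rewrite mulr_ge0// ltW].
(* Beyond X2 one has |P| <= f/4, whence f - v - P >= f/4 as v <= f/2. *)
pose X := Num.max (xs + 1) (Num.max 1 X2).
have [X_xs X_1 X_2] : [/\ xs + 1 <= X, 1 <= X & X2 <= X].
  by rewrite /X !le_max !lexx !orbT.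
have xsX : xs < X by apply: lt_le_trans X_xs; rewrite ltrDl.
have X_gt0 : 0 < X by exact: lt_le_trans X_1.
have xs_lt x : X <= x -> xs < x by exact: lt_le_trans.
exists X, (4 * K1), p; split => //; first by rewrite mulr_gt0.
have f_ge0 (x : R) : 0 <= x `^ gamma by exact: powR_ge0.
have v_bnd x : X <= x -> 0 <= u1 x / u x <= x `^ gamma / 2.
  move=> Xx; have xsx := ltW (xs_lt _ Xx).
  have ux := eigenfunction_gt0 gamma_gt0 u_eig xs_turning u_xs_ge0 xsx.
  rewrite divr_ge0 ?(ltW ux)//=; last first.
    exact: ltW (eigenfunction_derive_gt0 gamma_gt0 lambda_gt0 u_eig xs_turning u_xs_ge0 xsx).
  rewrite ler_pdivrMr//.
  exact: (eigenfunction_derive_le gamma_gt0 u_eig xs_turning u_xs_ge0 xsx).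
have P_bnd x : X <= x -> `|P x| <= x `^ gamma / 4.
  move=> Xx; have x_gt0 : 0 < x by exact: lt_le_trans Xx.
  apply: (le_trans (P_le _ (xs_lt _ Xx) (le_trans X_1 Xx))).
  rewrite powRN ler_pdivrMr ?powR_gt0//.
  have := X2_le _ (le_trans X_2 Xx).
  rewrite powRD; last by rewrite (gt_eqF x_gt0) implybT.
  by lra.
apply: (@unstable_bound R gamma X p (4 * K1) (fun x => u1 x / u x - P x)
  (fun x => x `^ gamma - u1 x / u x - P x) r) => //.
- lra.
- by rewrite mulr_ge0// ltW.
- move=> x Xx; have xsx := xs_lt _ Xx.
  have := is_derive_add (is_derive_log_derivative gamma_gt0 u_eig xs_turning u_xs_ge0 (ltW xsx))
    (is_derive_opp (PD _ xsx)).
  by move/is_derive_eq; apply; rewrite /r; ring.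
- move=> x Xx; have := v_bnd _ Xx; have := P_bnd _ Xx; have := ler_norm (P x).
  by move=> ? ? /andP[] *; lra.
- move=> x Xx; have x_gt0 : 0 < x by exact: lt_le_trans Xx.
  apply: (le_trans (r_le _ (xs_lt _ Xx) (le_trans X_1 Xx))).
  rewrite powRD; last by rewrite (gt_eqF x_gt0) implybT.
  by rewrite le_eqVlt; apply/orP; left; apply/eqP; rewrite -/p; field.
- move=> x Xx; have /andP[v0 v1] := v_bnd _ Xx; have := P_bnd _ Xx.
  have := f_ge0 x; rewrite !ler_norml => ? /andP[? ?]; lra.
Qed.

Lemma approx_expR_of_expansion (h : R -> R) :
  {within `[xs, +oo[, continuous h} ->
  (forall x, xs < x -> is_derive x 1 h (P x)) ->
  approx_on `[xs, +oo[ u (fun x => expR (h x)).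
Proof.
move=> h_cont hD.
have [X [K [p [X_1 xsX p_gt1 K_gt0 vP_le]]]] := log_derivative_expansion.
have lnD := is_derive_ln_eigenfunction gamma_gt0 u_eig xs_turning u_xs_ge0.
pose g x := ln (u x) - h x.
have [||x Xx|L gL] := @bounded_of_derive_decay R g (fun x => u1 x / u x - P x)
    xs X K p _ (ltW xsX) p_gt1 (ltW K_gt0) _ _ vP_le.
- exact: lt_le_trans X_1.
- apply: within_continuousB.
    apply: continuous_in_subspaceT => y /[!inE]/= /[!in_itv]/= /andP[xsy _].
    by apply: is_derive_continuous; exact: lnD.
  by apply: (continuous_subspaceW _ h_cont); exact: subset_itvl.
- apply: is_derive_add; first by apply: lnD; rewrite (le_trans (ltW xsX)).
  by apply: is_derive_opp; apply: hD; exact: lt_le_trans Xx.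
have L_ge0 : 0 <= L by exact: le_trans (gL _ (lexx xs)).
exists (expR L); first by rewrite -expR0 ler_expR.
move=> x /=; rewrite in_itv/= andbT => xsx.
have ux := eigenfunction_gt0 gamma_gt0 u_eig xs_turning u_xs_ge0 xsx.
have := gL _ xsx; rewrite /g ler_norml => /andP[lo hi].
rewrite -(lnK ux) -expRN -!expRD !ler_expR; lra.
Qed.

End RiccatiExpansion.

(** * The recursions for the terms *)

Section FormalExpansions.
Context {R : realType}.
Implicit Types (gamma lambda xs x : R) (S : nat -> R -> R).

Lemma term_order_le gamma k : 0 < gamma -> (1 <= k)%N ->
  term_order gamma k <= - gamma.
Proof.
move=> gamma_gt0 k_ge1; rewrite /term_order ge_max !lerN2.
have k1 : 1 <= k%:R :> R by rewrite ler1n.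
apply/andP; split; last by lra.
by rewrite -[leLHS]mul1r ler_wpM2r// ?(ltW gamma_gt0)//; lra.
Qed.

Lemma is_derive_first_term gamma lambda xs (S1 : R -> R) : 0 < gamma -> 0 < xs ->
  (forall x, xs <= x ->
    S1 x = \int[lebesgue_measure]_(s in `[xs, x]) (lambda / derive1 (potential gamma) s)) ->
  (forall x, xs < x -> is_derive x 1 S1 (lambda * x `^ (- gamma))) /\
  {within `[xs, +oo[, continuous S1}.
Proof.
move=> gamma_gt0 xs_gt0 S1E.
pose c s : R := lambda * s `^ (- gamma).
pose I x : R := \int[lebesgue_measure]_(s in `[xs, x]) c s.
have S1I x : xs <= x -> S1 x = I x.
  move=> xsx; rewrite S1E//; apply: eq_Rintegral => s.
  rewrite inE/= in_itv/= => /andP[xss _].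
  by rewrite (derive1_potential gamma_gt0 (lt_le_trans xs_gt0 xss)) /c powRN.
have c_cont s : 0 < s -> {for s, continuous c}.
  move=> s_gt0; apply: is_derive_continuous.
  by apply: is_derive_scale; exact: is_derive_powR.
have c_int x : lebesgue_measure.-integrable `[xs, x] (EFin \o c).
  apply: continuous_compact_integrable; first exact: segment_compact.
  apply: continuous_in_subspaceT => s /[!inE]/= /[!in_itv]/= /andP[xss _].
  by apply: c_cont; exact: lt_le_trans xss.
have S1D x : xs < x -> is_derive x 1 S1 (lambda * x `^ (- gamma)).
  move=> xsx.
  apply: (is_derive_near_right xsx (fun y xsy => esym (S1I y (ltW xsy)))).
  have xx1 : x < x + 1 by rewrite ltrDl.
  have [ID IE] := continuous_FTC1_closed xx1 (c_int _) xsx (c_cont _ (lt_trans xs_gt0 xsx)).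
  by apply: DeriveDef; [exact: ID|rewrite -derive1E; exact: IE].
split => //; apply/continuous_within_itvcyP; split.
  move=> x; rewrite in_itv/= andbT => xsx.
  exact: is_derive_continuous (S1D x xsx).
have xs1 : xs < xs + 1 by rewrite ltrDl.
have := parameterized_integral_continuous (ltW xs1) (c_int _).
move=> /(continuous_within_itvP _ xs1)[_ + _].
rewrite -[X in _ --> X -> _]/(I xs) -S1I//; apply: cvg_trans.
apply: near_eq_cvg; near=> x; apply/esym/S1I.
by near: x; exact: nbhs_right_ge.
Unshelve. all: by end_near. Qed.

(** Every S_k' is a finite sum of powers: the leading exponent -(2k-1)gamma comes
    from the products alone, and each differentiation in the recursion lowers
    the exponent to at most -(1+2gamma). *)
Lemma expansion_power_sum gamma lambda xs S : 0 < gamma -> 0 < xs ->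
  expansion (derive1 (potential gamma)) lambda xs S ->
  forall k, (1 <= k)%N -> power_sum xs (term_order gamma k) (derive1 (S k)).
Proof.
move=> gamma_gt0 xs_gt0 [S1E SkE]; have xs_ge0 := ltW xs_gt0.
elim/ltn_ind => k IHk k_ge1; have [k_ge2|k_lt2] := leqP 2 k; last first.
  have -> : k = 1%N by apply/eqP; rewrite eqn_leq k_ge1 -ltnS k_lt2.
  apply: (power_sum_term (c := lambda) (e := - gamma)).
    by rewrite /term_order le_max mulr1 lerN2; apply/orP; left; lra.
  move=> x xsx; have [S1D _] := is_derive_first_term gamma_gt0 xs_gt0 S1E.
  by rewrite derive1E; have [_ ->] := S1D x xsx.
have [_ _ SkD] := SkE k k_ge2.
have k1_ge1 : (1 <= k.-1)%N by rewrite -ltnS prednK// ltnW.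
have k1_lt : (k.-1 < k)%N by rewrite prednK// ltnW.
have [dq dq_sum qD] := power_sum_derive xs_ge0 (IHk _ k1_lt k1_ge1).
have Vinv : power_sum xs (- gamma) (fun x => (derive1 (potential gamma) x)^-1).
  apply: (power_sum_term (c := 1) (lexx _)) => x xsx.
  by rewrite (derive1_potential gamma_gt0 (lt_trans xs_gt0 xsx)) mul1r powRN.
have order_k1 := term_order_le gamma_gt0 k1_ge1.
have order_k : - (1 + 2 * gamma) <= term_order gamma k.
  by rewrite /term_order le_max lexx orbT.
apply: (power_sum_eq _ (fun x xsx => (SkD x xsx).2)).
apply: power_sumD.
- have : power_sum xs (- gamma + (term_order gamma k.-1 - 1))
      (fun x => (derive1 (potential gamma) x)^-1 * dq x).
    exact: power_sumM.
  move=> /(power_sumW (b' := term_order gamma k)) h.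
  apply: (power_sum_eq (h _)); first by lra.
  move=> x xsx; congr (_ * _); rewrite /derive1n/= derive1E.
  by have [_ ->] := qD x xsx.
- have -> : term_order gamma k = - gamma + (term_order gamma k + gamma).
    by rewrite addrC addrK.
  apply: power_sumM => //; apply: power_sum_sum => j.
  rewrite mem_index_iota => /andP[j_ge1 jk] _.
  have kj_ge1 : (1 <= k - j)%N by rewrite subn_gt0.
  have kj_lt : (k - j < k)%N by rewrite ltn_subrL j_ge1 (leq_trans _ jk).
  apply: power_sumW (power_sumM xs_ge0 (IHk _ jk j_ge1) (IHk _ kj_lt kj_ge1)).
  have := term_order_le gamma_gt0 j_ge1; have := term_order_le gamma_gt0 kj_ge1.
  have : (2 * k%:R - 1) * gamma = (2 * j%:R - 1) * gamma + (2 * (k - j)%:R - 1) * gamma + gamma :> R.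
    by rewrite natrB ?(ltnW jk)//; ring.
  rewrite /term_order.
  case: (leP (- ((2 * k%:R - 1) * gamma)) (- (1 + 2 * gamma)));
  case: (leP (- ((2 * j%:R - 1) * gamma)) (- (1 + 2 * gamma)));
  case: (leP (- ((2 * (k - j)%:R - 1) * gamma)) (- (1 + 2 * gamma))); lra.
Qed.

Lemma expansion_derive gamma lambda xs S k : 0 < gamma -> 0 < xs ->
  expansion (derive1 (potential gamma)) lambda xs S -> (1 <= k)%N ->
  {within `[xs, +oo[, continuous (S k)} /\
  forall x, xs < x -> is_derive x 1 (S k) (derive1 (S k) x).
Proof.
move=> gamma_gt0 xs_gt0 [S1E SkE] k_ge1; have [k_ge2|k_lt2] := leqP 2 k.
  have [_ Sk_cont SkD] := SkE k k_ge2; split=> // x xsx.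
  by rewrite derive1E; apply: derivableP; have [] := SkD x xsx.
have -> : k = 1%N by apply/eqP; rewrite eqn_leq k_ge1 -ltnS k_lt2.
have [S1D S1_cont] := is_derive_first_term gamma_gt0 xs_gt0 S1E.
by split=> // x xsx; rewrite derive1E; apply: derivableP; have [] := S1D x xsx.
Qed.

(** Each coefficient depends on all the previous ones, so the list of them is
    built by recursion. *)
Fixpoint convolution_prefix lambda (n : nat) : seq R :=
  if n is n'.+1 then
    let s := convolution_prefix lambda n' in
    rcons s (if n' == 1%N then lambda else \sum_(1 <= j < n') s`_j * s`_(n' - j))
  else [::].

(** This is lambda^k times the (k-1)-st Catalan number, for k >= 1. *)
Definition convolution_coef lambda (k : nat) : R :=
  (convolution_prefix lambda k.+1)`_k.

Lemma size_convolution_prefix lambda n : size (convolution_prefix lambda n) = n.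
Proof. by elim: n => //= n IHn; rewrite size_rcons IHn. Qed.

Lemma nth_convolution_prefix lambda n k : (k < n)%N ->
  (convolution_prefix lambda n)`_k = convolution_coef lambda k.
Proof.
elim: n => // n IHn; rewrite ltnS leq_eqVlt => /predU1P[->//|kn].
by rewrite /= nth_rcons size_convolution_prefix kn IHn.
Qed.

Lemma convolution_coef1 lambda : convolution_coef lambda 1 = lambda.
Proof. by []. Qed.

Lemma convolution_coef_rec lambda k : (2 <= k)%N ->
  convolution_coef lambda k =
  \sum_(1 <= j < k) convolution_coef lambda j * convolution_coef lambda (k - j).
Proof.
move=> k_ge2; rewrite /convolution_coef /= nth_rcons size_convolution_prefix ltnn eqxx.
rewrite gtn_eqF//; apply: eq_big_nat => j /andP[j_ge1 jk].
rewrite !nth_convolution_prefix// ltn_subrL j_ge1.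
exact: ltnW.
Qed.

End FormalExpansions.

(** * Comparison with the explicit exponentials *)

Section ExplicitAsymptotics.
Context {R : realType} (gamma lambda xs : R) (u : R -> R).
Hypotheses (gamma_gt0 : 0 < gamma) (lambda_gt0 : 0 < lambda).
Hypothesis u_eig : ode_eigenfunction (potential gamma) lambda u.
Hypothesis xs_turning : turning_point (potential gamma) lambda xs.
Hypothesis u_xs_ge0 : 0 <= u xs.

Let xs_gt0 : 0 < xs. Proof. by case: xs_turning. Qed.

Lemma approx_expR_expansion (n : nat) (S : nat -> R -> R) :
  (0 < n)%N -> 1 < (2 * n%:R + 1) * gamma ->
  expansion (derive1 (potential gamma)) lambda xs S ->
  approx_on `[xs, +oo[ u (fun x => expR (\sum_(1 <= i < n.+1) S i x)).
Proof.
move=> n_gt0 n_large S_exp.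
have S_sum := expansion_power_sum gamma_gt0 xs_gt0 S_exp.
have S_der := fun k => @expansion_derive _ _ _ _ _ k gamma_gt0 xs_gt0 S_exp.
apply: (@approx_expR_of_expansion _ _ _ _ _ gamma_gt0 lambda_gt0 u_eig
  xs_turning u_xs_ge0 n (fun k => derive1 (S k))
  (fun k => derive1 (derive1 (S k.-1)))) => //.
- by move=> k /andP[k_ge1 _]; exact: S_sum.
- move=> k /andP[k_ge2 _]; have k1_ge1 : (1 <= k.-1)%N by rewrite -ltnS prednK// ltnW.
  have [dq dq_sum qD] := power_sum_derive (ltW xs_gt0) (S_sum _ k1_ge1).
  have dq_sum' : power_sum xs (- (1 + gamma)) dq.
    apply: power_sumW dq_sum; have := term_order_le gamma_gt0 k1_ge1; lra.
  apply: (power_sum_eq dq_sum') => x xsx; rewrite derive1E.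
  by have [_ ->] := qD x xsx.
- move=> x xsx; have x_gt0 : 0 < x by exact: lt_trans xsx.
  have [S1D _] := is_derive_first_term gamma_gt0 xs_gt0 S_exp.1.
  rewrite derive1E; have [_ ->] := S1D x xsx.
  by rewrite powRN mulrCA divff ?mulr1// gt_eqF// powR_gt0.
- move=> k /andP[k_ge2 _] x xsx; have x_gt0 : 0 < x by exact: lt_trans xsx.
  have [_ _ /(_ x xsx)[_ ->]] := S_exp.2 k k_ge2.
  rewrite (derive1_potential gamma_gt0 x_gt0) -mulrDr mulrA divff ?mul1r 1?addrC//.
  by rewrite gt_eqF// powR_gt0.
- apply: within_continuous_sum => i; rewrite mem_index_iota => /andP[i_ge1 _].
  by have [] := S_der i i_ge1.
- move=> x xsx; apply: is_derive_sum_nat => i /andP[i_ge1 _].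
  by have [_ SiD] := S_der i i_ge1; exact: SiD.
Qed.

(** With the derivative dropped from the recursion, the expansion consists of
    the leading powers of the S_k' alone, which differ from S_k' by functions
    integrable at infinity. *)
Lemma approx_expR_leading_powers (N : nat) (h : R -> R) :
  (0 < N)%N -> 1 < (2 * N%:R + 1) * gamma ->
  (forall x : R, 0 < x -> is_derive x 1 h (\sum_(1 <= k < N.+1)
     convolution_coef lambda k * x `^ (- ((2 * k%:R - 1) * gamma)))) ->
  approx_on `[xs, +oo[ u (fun x => expR (h x)).
Proof.
move=> N_gt0 N_large hD.
apply: (@approx_expR_of_expansion _ _ _ _ _ gamma_gt0 lambda_gt0 u_eig
  xs_turning u_xs_ge0 N
  (fun k x => convolution_coef lambda k * x `^ (- ((2 * k%:R - 1) * gamma)))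
  (fun=> fun=> 0)) => //.
- move=> k _; apply: (power_sum_term (e := - ((2 * k%:R - 1) * gamma))) => //.
  by rewrite /term_order le_max lexx.
- by move=> k _; exact: power_sum0.
- move=> x xsx; have x_gt0 : 0 < x by exact: lt_trans xsx.
  rewrite convolution_coef1 mulr1 (_ : 2 - 1 = 1 :> R) ?mul1r; last by ring.
  by rewrite powRN mulrCA divff ?mulr1// gt_eqF// powR_gt0.
- move=> k /andP[k_ge2 _] x xsx; have x_gt0 : 0 < x by exact: lt_trans xsx.
  rewrite convolution_coef_rec// addr0 mulr_suml mulr_sumr.
  apply: eq_big_nat => j /andP[j_ge1 jk].
  have -> : - ((2 * k%:R - 1) * gamma) =
      - gamma + (- ((2 * j%:R - 1) * gamma) + - ((2 * (k - j)%:R - 1) * gamma)).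
    by rewrite natrB ?(ltnW jk)//; ring.
  have powD r s : x `^ (r + s) = x `^ r * x `^ s.
    by rewrite powRD// (gt_eqF x_gt0) implybT.
  rewrite !powD powRN; field; rewrite gt_eqF// powR_gt0//.
- apply: continuous_in_subspaceT => x /[!inE]/= /[!in_itv]/= /andP[xsx _].
  by apply: is_derive_continuous; apply: hD; exact: lt_le_trans xsx.
- by move=> x xsx; apply: hD; exact: lt_trans xsx.
Qed.

(** In the exceptional case the k-th leading power is D_k / x, with
    antiderivative D_k ln x. *)
Definition antiderivative_coef (k : nat) : R :=
  if (2 * k%:R - 1) * gamma == 1 then convolution_coef lambda k
  else convolution_coef lambda k / (1 - (2 * k%:R - 1) * gamma).

Lemma is_derive_abs_powR (e x : R) : 0 < x ->
  is_derive x 1 (fun y => `|y| `^ e) (e * x `^ (e - 1)).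
Proof.
move=> x_gt0; apply: (is_derive_near_right x_gt0 _ (is_derive_powR e x_gt0)).
by move=> y y_gt0; rewrite gtr0_norm.
Qed.

Lemma is_derive_leading_power (k : nat) (x : R) : 0 < x ->
  (2 * k%:R - 1) * gamma != 1 ->
  is_derive x 1
    (fun y => antiderivative_coef k * `|y| `^ (1 - (2 * k%:R - 1) * gamma))
    (convolution_coef lambda k * x `^ (- ((2 * k%:R - 1) * gamma))).
Proof.
move=> x_gt0 e_neq1.
have := is_derive_scale (antiderivative_coef k)
  (is_derive_abs_powR (1 - (2 * k%:R - 1) * gamma) x_gt0).
rewrite addrAC subrr add0r /antiderivative_coef (negPf e_neq1) mulrA divfK//.
by rewrite subr_eq0 eq_sym.
Qed.

Lemma is_derive_first_power (x : R) : 0 < x -> gamma != 1 ->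
  is_derive x 1 (fun y => lambda * (`|y| `^ (1 - gamma) / (1 - gamma)))
    (convolution_coef lambda 1 * x `^ (- ((2 * 1%:R - 1) * gamma))).
Proof.
move=> x_gt0 g_neq1.
have e1 : (2 * 1%:R - 1) * gamma = gamma by ring.
have := @is_derive_leading_power 1 x x_gt0; rewrite e1 => /(_ g_neq1).
rewrite /antiderivative_coef e1 (negPf g_neq1) convolution_coef1.
by under eq_fun do rewrite mulrAC -mulrA.
Qed.

Lemma is_derive_leading_log (k : nat) (x : R) : 0 < x ->
  (2 * k%:R - 1) * gamma = 1 ->
  is_derive x 1 (fun y => antiderivative_coef k * ln `|y|)
    (convolution_coef lambda k * x `^ (- ((2 * k%:R - 1) * gamma))).
Proof.
move=> x_gt0 e1; rewrite /antiderivative_coef e1 eqxx powRN powRr1 ?ltW//.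
apply: is_derive_scale.
apply: (is_derive_near_right x_gt0 _ (is_derive1_ln x_gt0)).
by move=> y y_gt0; rewrite gtr0_norm.
Qed.

Lemma approx_expR_powers (n : nat) :
  (0 < n)%N -> 1 < (2 * n%:R + 1) * gamma ->
  (forall k : nat, (1 <= k)%N -> (2 * k%:R - 1) * gamma != 1) ->
  approx_on `[xs, +oo[ u
    (fun x => expR (lambda * (`|x| `^ (1 - gamma) / (1 - gamma))
       + \sum_(2 <= i < n.+1)
           antiderivative_coef i * `|x| `^ (1 - (2 * i%:R - 1) * gamma))).
Proof.
move=> n_gt0 n_large e_neq1; apply: (approx_expR_leading_powers n_gt0 n_large) => x x_gt0.
rewrite big_ltn ?ltnS//; apply: is_derive_add.
  apply: is_derive_first_power => //; have := e_neq1 1%N isT.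
  by rewrite (_ : (2 * 1%:R - 1) * gamma = gamma) //; ring.
apply: is_derive_sum_nat => k /andP[k_ge2 _].
by apply: is_derive_leading_power => //; apply: e_neq1; exact: ltnW.
Qed.

(** The expansion may stop at the logarithm, N = m: the next leading power,
    of exponent -(2m+1)gamma = -1 - 2 gamma, is already integrable. *)
Lemma approx_expR_powers_log (m : nat) :
  (2 <= m)%N -> (2 * m%:R - 1) * gamma = 1 ->
  approx_on `[xs, +oo[ u
    (fun x => expR (lambda * (`|x| `^ (1 - gamma) / (1 - gamma))
       + \sum_(2 <= i < m)
           antiderivative_coef i * `|x| `^ (1 - (2 * i%:R - 1) * gamma)
       + antiderivative_coef m * ln `|x|)).
Proof.
move=> m_ge2 e_eq1; have g_gt0 := gamma_gt0.
have e_neq1 k : (1 <= k < m)%N -> (2 * k%:R - 1) * gamma != 1.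
  move=> /andP[_ km]; have : k%:R * gamma < m%:R * gamma by rewrite ltr_pM2r// ltr_nat.
  by move=> ?; rewrite lt_eqF//; lra.
apply: (approx_expR_leading_powers (N := m)); first exact: ltnW.
  by lra.
move=> x x_gt0; rewrite big_nat_recr/=; last exact: ltnW.
apply: is_derive_add; last exact: is_derive_leading_log.
rewrite big_ltn//; apply: is_derive_add.
  apply: is_derive_first_power => //; have := e_neq1 1%N m_ge2.
  by rewrite (_ : (2 * 1%:R - 1) * gamma = gamma) //; ring.
apply: is_derive_sum_nat => k /andP[k_ge2 km].
by apply: is_derive_leading_power => //; apply: e_neq1; rewrite km ltnW.
Qed.

End ExplicitAsymptotics.

Theorem theorem2p3 (R : realType) (gamma : R) (gamma_gt0 : 0 < gamma)
    (lambda : R) (lambda_gt0 : 0 < lambda)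
    (lambda_eig : ode_eigenvalue (potential gamma) lambda)
    (u : R -> R) (u_eig : ode_eigenfunction (potential gamma) lambda u)
    (xs : R) (xs_turning : turning_point (potential gamma) lambda xs)
    (n : nat) (n_large : (1 + gamma) / (2 * gamma) < n%:R)
    (u_xs_ge0 : 0 <= u xs) :
  (forall S : nat -> R -> R,
     expansion (derive1 (potential gamma)) lambda xs S ->
     approx_on `[xs, +oo[ u (fun x => expR (\sum_(1 <= i < n.+1) S i x)))
  /\
  exists C : nat -> R,
    ((forall p : nat, odd p -> gamma^-1 <> p%:R) ->
     approx_on `[xs, +oo[ u
       (fun x => expR (lambda * (`|x| `^ (1 - gamma) / (1 - gamma))
          + \sum_(2 <= i < n.+1) C i * `|x| `^ (1 - (2 * i%:R - 1) * gamma))))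
    /\
    (forall m : nat, (2 <= m < n)%N -> gamma = 1 / (2 * m%:R - 1) ->
     approx_on `[xs, +oo[ u
       (fun x => expR (lambda * (`|x| `^ (1 - gamma) / (1 - gamma))
          + \sum_(2 <= i < m) C i * `|x| `^ (1 - (2 * i%:R - 1) * gamma)
          + C m * ln `|x|))).
Proof.
have n_gt0 : (0 < n)%N.
  rewrite -(ltr_nat R); apply: le_lt_trans n_large.
  by rewrite divr_ge0// ?mulr_ge0// ?addr_ge0// ltW.
have n_gamma : 1 + gamma < 2 * n%:R * gamma.
  by move: n_large; rewrite ltr_pdivrMr ?mulr_gt0//; lra.
have n_ok : 1 < (2 * n%:R + 1) * gamma by lra.
split; first by move=> S; exact: (approx_expR_expansion gamma_gt0 lambda_gt0 u_eig).
exists (antiderivative_coef gamma lambda); split=> [not_odd|m /andP[m_ge2 mn] gammaE].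
- apply: (approx_expR_powers gamma_gt0 lambda_gt0 u_eig) => // k k_ge1.
  have k2 : (2 * k).-1.+1 = (2 * k)%N by rewrite prednK// muln_gt0.
  apply/eqP => e1; apply: (not_odd (2 * k).-1).
    by rewrite -[odd _]negbK -oddS k2 oddM.
  have -> : (2 * k).-1%:R = 2 * k%:R - 1 :> R.
    by apply/eqP; rewrite eq_sym subr_eq natr1 k2 natrM.
  by apply: (mulIf (lt0r_neq0 gamma_gt0)); rewrite e1 mulVf// lt0r_neq0.
- apply: (approx_expR_powers_log gamma_gt0 lambda_gt0 u_eig) => //.
  have m_ge1 : 1 <= m%:R :> R by rewrite ler1n ltnW.
  by rewrite gammaE; field; lra.
Qed.
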